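(* For every odd integer $k\ge 5$, there are infinitely many (pairwise non-isomorphic) claw-free minimal $W_k$-obstructions.
   Context: All graphs are finite and simple. For an odd integer $k\ge 5$, $W_k$ is the graph obtained from the cycle on $k$ vertices by adding a vertex adjacent to all vertices of the cycle. The claw is $K_{1,3}$; a graph is claw-free if it does not contain the claw as an induced subgraph. For a graph $H$, a graph $G$ is a claw-free minimal $H$-obstruction if $G$ is claw-free, $G$ does not admit a homomorphism (edge-preserving vertex map) to $H$, and every induced subgraph of $G$ other than $G$ itself admits a homomorphism to $H$. *)

(* Defs.v *)
From mathcomp Require Import all_boot.

Set Implicit Arguments.
Unset Strict Implicit.
Unset Printing Implicit Defensive.

Record sgraph := SGraph {
  vertex :> finType;
  adj : rel vertex;
  adj_sym : symmetric adj;
  adj_irrefl : irreflexive adj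
}.

Definition is_hom (G H : sgraph) (f : G -> H) : Prop :=
  {homo f : x y / adj x y}.

Definition has_hom (G H : sgraph) : Prop := exists f : G -> H, is_hom f.

Definition isomorphic (G H : sgraph) : Prop :=
  exists2 f : G -> H, bijective f & {mono f : x y / adj x y}.

Section Induced.
Variables (G : sgraph) (S : {set G}).

Definition induced_adj : rel {x : G | x \in S} :=
  fun x y => adj (val x) (val y).

Fact induced_sym : symmetric induced_adj.
Proof. by move=> x y; apply: adj_sym. Qed.

Fact induced_irrefl : irreflexive induced_adj.
Proof. by move=> x; apply: adj_irrefl. Qed.

Definition induced : sgraph := SGraph induced_sym induced_irrefl.
End Induced.

Section CompleteBipartite.
Variables m n : nat.

Definition bipartite_adj : rel ('I_m + 'I_n)%type :=
  fun x y => match x, y with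
             | inl _, inr _ | inr _, inl _ => true
             | _, _ => false
             end.

Fact bipartite_sym : symmetric bipartite_adj.
Proof. by move=> [x|x] [y|y]. Qed.

Fact bipartite_irrefl : irreflexive bipartite_adj.
Proof. by move=> [x|x]. Qed.

Definition complete_bipartite : sgraph := SGraph bipartite_sym bipartite_irrefl.
End CompleteBipartite.

Definition claw : sgraph := complete_bipartite 1 3.

Definition claw_free (G : sgraph) : Prop :=
  ~ exists S : {set G}, isomorphic (induced S) claw.

Section Cycle.
Variable k : nat.

(* [ordS i] is [i + 1] modulo [k]; the conjunct [i != j] only matters for
   [k = 1], where [ordS i = i]. *)
Definition cycle_adj : rel 'I_k :=
  fun i j => (i != j) && ((ordS i == j) || (ordS j == i)).

Fact cycle_sym : symmetric cycle_adj.
Proof. by move=> i j; rewrite /cycle_adj eq_sym orbC. Qed.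

Fact cycle_irrefl : irreflexive cycle_adj.
Proof. by move=> i; rewrite /cycle_adj eqxx. Qed.

Definition cycle_graph : sgraph := SGraph cycle_sym cycle_irrefl.
End Cycle.

Section Cone.
Variable G : sgraph.

Definition cone_adj : rel (option G) :=
  fun x y => match x, y with
             | Some u, Some v => adj u v
             | None, None => false
             | _, _ => true
             end.

Fact cone_sym : symmetric cone_adj.
Proof. by move=> [x|] [y|] //=; apply: adj_sym. Qed.

Fact cone_irrefl : irreflexive cone_adj.
Proof. by move=> [x|] //=; apply: adj_irrefl. Qed.

(* [None] is the added universal vertex. *)
Definition cone : sgraph := SGraph cone_sym cone_irrefl.
End Cone.

(* [wheel k] has [k + 1] vertices: [k] counts the rim only. *)
Definition wheel (k : nat) : sgraph := cone (cycle_graph k).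

Definition claw_free_minimal_obstruction (H G : sgraph) : Prop :=
  [/\ claw_free G,
      ~ has_hom G H
    & forall S : {set G}, S != setT -> has_hom (induced S) H].

(* Main.v *)
Require Import Defs.
From mathcomp Require Import all_boot.
From mathcomp Require Import zify.

(** It is enough to find claw-free graphs without a homomorphism to the wheel in
    which arbitrarily many vertices are critical, in the sense that deleting any
    one of them creates a homomorphism: a minimal induced subgraph without a
    homomorphism is an obstruction, it is still claw-free, and it must contain
    all the critical vertices ([minimal_obstruction_inside]). Obstructions of
    unbounded size then yield pairwise non-isomorphic ones
    ([unbounded_nonisomorphic_family]).

    Since the rim of the wheel is triangle-free, a homomorphism to the wheel
    sends exactly one vertex of every triangle to the hub
    ([wheel_triangle_hub]). Hence in a diamond (two triangles sharing an edge)
    the two non-adjacent vertices are both sent to the hub or both not. Take a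
    chain of [n] diamonds, whose joints a_0, ..., a_n are then all sent to the
    hub or all not, make a_0 and a_n adjacent, and add an apex adjacent to both.
    Adjacent vertices cannot both go to the hub, so no joint does, and the
    triangle formed by a_0, a_n and the apex forces the apex to the hub. Two
    such rings with adjacent apexes have no homomorphism to the wheel
    ([twin_rings_no_hom]). The graph is claw-free because it is the line graph of
    a multigraph ([line_graph_claw_free]).

    Every joint is critical. In an intact ring, send the apex and one middle
    vertex of each diamond to the hub; what is left is the odd cycle through the
    joints and the other middle vertices, which has 2n+1 vertices and maps to
    the rim as soon as 2n+1 >= k. A ring that lost a joint no longer transmits
    the hub status all the way round, and three pairwise adjacent colours
    suffice for it, with the apex off the hub ([broken_colouring_hom]). *)

Set Implicit Arguments.
Unset Strict Implicit.
Unset Printing Implicit Defensive.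

(** * Minimal obstructions inside a graph *)

(** A boolean form, so that a minimal set of vertices can be extracted. *)
Definition has_homb (G H : sgraph) : bool :=
  [exists f : {ffun G -> H}, [forall x, forall y, adj x y ==> adj (f x) (f y)]].

Lemma has_homP (G H : sgraph) : reflect (has_hom G H) (has_homb G H).
Proof.
apply: (iffP existsP) => [[f /forallP Hf]|[f Hf]].
  by exists f => x y; apply/implyP; move/forallP: (Hf x); apply.
exists [ffun x => f x]; apply/forallP => x; apply/forallP => y.
by rewrite !ffunE; apply/implyP; apply: Hf.
Qed.

Lemma induced_hom_sub (G H : sgraph) (S : {set G}) (T : {set induced S}) :
  has_hom (induced (val @: T)) H -> has_hom (induced T) H.
Proof.
move=> [f Hf].
by exists (fun x => f (Sub (val (val x)) (imset_f val (valP x)))) => x y xy; apply: Hf.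
Qed.

(** An induced subgraph of an induced subgraph is, up to the nested subtypes, the
    graph induced by the image of its vertex set. *)
Lemma claw_free_induced (G : sgraph) (S : {set G}) :
  claw_free G -> claw_free (induced S).
Proof.
move=> cfG [T [f f_bij f_mono]]; apply: cfG; exists (val @: T).
have TS x : x \in val @: T -> x \in S by case/imsetP => y _ ->; apply: valP.
pose inS x (xT : x \in val @: T) : induced S := exist _ x (TS x xT).
have TP x (xT : x \in val @: T) : inS x xT \in T.
  have [y yT xE] := imsetP xT.
  by rewrite (_ : inS x xT = y) //; apply: val_inj.
pose g (x : induced (val @: T)) : induced T := 
  exist _ (inS _ (valP x)) (TP _ (valP x)).
exists (f \o g).
  apply: bij_comp f_bij _.
  exists (fun x : induced T =>
            Sub (val (val x)) (imset_f val (valP x)) : induced (val @: T)).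
    by move=> x; apply: val_inj.
  by move=> x; do 2!apply: val_inj.
by move=> x y; apply: f_mono.
Qed.

(** The hypothesis on [A] says that each of its vertices is critical, so every
    induced subgraph without a homomorphism contains [A], in particular a
    minimal one. The conclusion is a sigma-type because the sequence of
    obstructions is built by recursion on the sizes reached so far. *)
Lemma minimal_obstruction_inside (G H : sgraph) (A : {set G}) :
    claw_free G -> ~ has_hom G H ->
    (forall S : {set G}, ~~ (A \subset S) -> has_hom (induced S) H) ->
  {K : sgraph | claw_free_minimal_obstruction H K & #|A| <= #|K|}.
Proof.
move=> cfG noG critA.
have PT : ~~ has_homb (induced [set: G]) H.
  apply/has_homP => -[f Hf]; apply: noG.
  by exists (fun x => f (Sub x (in_setT x))) => x y xy; apply: Hf.
have [S /minsetP [/has_homP noS minS] _] :=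
  minset_exists (P := fun S => ~~ has_homb (induced S) H) PT.
exists (induced S); last first.
  have sAS : A \subset S by apply/negP => /negP /critA.
  by apply: leq_trans (subset_leq_card sAS) _; rewrite card_sig.
split=> [|//|T neqT]; first exact: claw_free_induced.
apply: induced_hom_sub; apply/has_homP; apply: contraNT neqT => noT.
have sTS : val @: T \subset S by apply/subsetP => _ /imsetP [x _ ->]; apply: valP.
have TS := minS _ noT sTS.
apply/eqP/setP => x; rewrite inE.
have : val x \in val @: T by rewrite TS (valP x).
by case/imsetP => y yT /val_inj ->.
Qed.

Lemma isomorphic_card (G H : sgraph) : isomorphic G H -> #|G| = #|H|.
Proof. by case=> f f_bij _; apply: bij_eq_card f_bij. Qed.

Lemma unbounded_nonisomorphic_family (P : sgraph -> Prop) :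
    (forall N, {K : sgraph | P K & N < #|K|}) ->
  exists G : nat -> sgraph,
    (forall n, P (G n)) /\ (forall m n, m <> n -> ~ isomorphic (G m) (G n)).
Proof.
move=> big; pose next N := s2val (big N).
pose G := fix G n := if n is m.+1 then next #|G m| else next 0.
have PG n : P (G n) by case: n => [|n] /=; rewrite /next; case: (big _).
have ltG n : #|G n| < #|G n.+1| by rewrite /= /next; case: (big _).
exists G; split=> // m n neq_mn /isomorphic_card; move: neq_mn.
have incG := homo_ltn ltn_trans ltG.
by case: (ltngtP m n) => // /incG lt_mn _ eq_mn; rewrite eq_mn ltnn in lt_mn.
Qed.

(** * Line graphs of multigraphs *)

(** Parallel edges are needed: the two middle vertices of a diamond are the two
    edges of a digon. *)
Section LineGraph.
Variables (E : finType) (V : eqType) (src tgt : E -> V).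

Definition line_adj : rel E := fun x y =>
  (x != y) && [|| src x == src y, src x == tgt y, tgt x == src y | tgt x == tgt y].

Fact line_sym : symmetric line_adj.
Proof.
move=> x y; rewrite /line_adj eq_sym (eq_sym (src x)) (eq_sym (src x)).
by rewrite (eq_sym (tgt x)) (eq_sym (tgt x)); congr (_ && (_ || _)); rewrite orbCA.
Qed.

Fact line_irrefl : irreflexive line_adj.
Proof. by move=> x; rewrite /line_adj eqxx. Qed.

Definition line_graph : sgraph := SGraph line_sym line_irrefl.

(** Each of the three leaves of a claw would be an edge sharing an end with the
    centre. The centre has only two ends, so two leaves meet at the same one and
    are adjacent. *)
Lemma line_graph_claw_free : claw_free line_graph.
Proof.
case=> S [f [g fK gK] f_mono].
have adjE u v : adj (val (g u)) (val (g v)) = adj u v :> bool.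
  by rewrite -[in RHS](gK u) -[in RHS](gK v) f_mono.
pose c := val (g (inl ord0)); pose l i := val (g (inr i)).
have lc i : [|| src c == src (l i), src c == tgt (l i), tgt c == src (l i)
             | tgt c == tgt (l i)].
  by have := adjE (inl ord0) (inr i); rewrite /= /line_adj => /andP [].
pose at_src i := (src c == src (l i)) || (src c == tgt (l i)).
have far i j : i != j -> at_src i = at_src j -> False.
  move=> neq_ij eq_ij.
  have := adjE (inr i) (inr j); rewrite /= /line_adj => /negP; apply.
  apply/andP; split.
    by apply: contra neq_ij => /eqP /val_inj /(can_inj gK) [->].
  have on_src m : at_src m -> (src (l m) == src c) || (tgt (l m) == src c).
    by rewrite !(eq_sym _ (src c)).
  have on_tgt m : ~~ at_src m -> (src (l m) == tgt c) || (tgt (l m) == tgt c).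
    by move: (lc m); rewrite /at_src !(eq_sym _ (tgt c)) orbA => /orP [->|].
  have common v : (src (l i) == v) || (tgt (l i) == v) ->
      (src (l j) == v) || (tgt (l j) == v) ->
      [|| src (l i) == src (l j), src (l i) == tgt (l j), tgt (l i) == src (l j)
        | tgt (l i) == tgt (l j)].
    by do 2!case/orP => /eqP ->; rewrite eqxx ?orbT.
  case: (boolP (at_src i)) => ai; move: (ai); rewrite eq_ij => aj.
    exact: common (on_src i ai) (on_src j aj).
  exact: common (on_tgt i ai) (on_tgt j aj).
(* Three booleans cannot be pairwise distinct. *)
have [o0 o1 o2] : [/\ at_src (inord 0) = at_src (inord 1) -> False,
    at_src (inord 0) = at_src (inord 2) -> False
  & at_src (inord 1) = at_src (inord 2) -> False].
  by split; apply: far; rewrite -val_eqE /= !inordK.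
by move: o0 o1 o2; do 3!case: (at_src _) => //; auto.
Qed.

End LineGraph.

(** * Odd cycles and wheels *)

Lemma cycle_triangle_free (k : nat) (x y z : cycle_graph k) :
  3 < k -> adj x y -> adj y z -> adj x z -> False.
Proof.
move=> k_gt3; rewrite /= /cycle_adj -!val_eqE /=.
have S_mod (i : 'I_k) : i.+1 %% k = if i.+1 == k then 0 else i.+1.
  case: eqP => [->|ne]; first exact: modnn.
  by rewrite modn_small // ltn_neqAle ltn_ord andbT; apply/eqP.
rewrite !S_mod; have := ltn_ord x; have := ltn_ord y; have := ltn_ord z.
move=> hz hy hx; repeat case: ifP; lia.
Qed.

Definition is_hub (k : nat) (c : wheel k) : bool := ~~ isSome c.

Lemma wheel_triangle_hub (k : nat) (x y z : wheel k) : 3 < k ->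
  adj x y -> adj y z -> adj x z -> is_hub x + is_hub y + is_hub z = 1.
Proof.
move=> k_gt3; case: x y z => [x|] [y|] [z|] //= xy yz xz.
by case: (cycle_triangle_free k_gt3 xy yz xz).
Qed.

(** A walk on the rim that runs once through 0, ..., k-1 and then oscillates
    between k-2 and k-1. For odd [k] it is at k-1 at every even time from k-1
    on, so that it can be closed up after any odd number of steps at least [k]:
    this maps every long odd cycle to the rim. *)
Definition fold_walk (k i : nat) : nat :=
  if i < k then i else k.-1 - odd i.

Definition rim_colour (k i : nat) : wheel k.+1 := Some (inord (fold_walk k.+1 i)).

Lemma rim_colour_step (k i : nat) : odd k.+1 -> 1 < k ->
  adj (rim_colour k i) (rim_colour k i.+1).
Proof.
move=> k_odd k_gt1; rewrite /= /cycle_adj -!val_eqE /=.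
have lt_fold j : fold_walk k.+1 j < k.+1 by rewrite /fold_walk; case: ifP; lia.
rewrite !inordK //.
have : (fold_walk k.+1 i).+1 = fold_walk k.+1 i.+1 \/
       (fold_walk k.+1 i.+1).+1 = fold_walk k.+1 i.
  by rewrite /fold_walk; do 2!case: ifP; lia.
have := lt_fold i; have := lt_fold i.+1.
move: (fold_walk _ i) (fold_walk _ i.+1) => p q hq hp [] E.
  by rewrite (modn_small (m := p.+1)) E ?eqxx //; lia.
by rewrite (modn_small (m := q.+1)) E ?eqxx ?orbT //; lia.
Qed.

Lemma rim_colour_close (k n : nat) : odd k.+1 -> 1 < k -> k <= n.*2 ->
  adj (rim_colour k 0) (rim_colour k n.*2).
Proof.
move=> k_odd k_gt1 le_kn; rewrite /= /cycle_adj -!val_eqE /=.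
have -> : fold_walk k.+1 0 = 0 by [].
have -> : fold_walk k.+1 n.*2 = k by rewrite /fold_walk; case: ifP; lia.
by rewrite !inordK // modnn eqxx orbT andbT; lia.
Qed.

(** * Twin rings of diamonds *)

Section TwinRings.
Variable n : nat.

(** In the ring [b], [joint b i] is a_i; [mid b i true] and [mid b i false] are
    the middle vertices of the diamond between a_i and a_(i+1). *)
Definition edge : finType := (bool * option ('I_n.+1 + 'I_n * bool))%type.

Definition apex (b : bool) : edge := (b, None).
Definition joint (b : bool) (i : 'I_n.+1) : edge := (b, Some (inl i)).
Definition mid (b : bool) (i : 'I_n) (t : bool) : edge := (b, Some (inr (i, t))).

(** The multigraph whose line graph is wanted. [None] is the common end of the
    two apexes. The others are the two ends [(b, (i, false))] and
    [(b, (i, true))] of a_i, except that the far end of a_n is glued to the near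
    end [(b, (0, false))] of a_0; the apex is attached at this point. *)
Definition point : eqType := option (bool * (nat * bool)).

Definition edge_src (x : edge) : point :=
  match x with
  | (b, None) => None
  | (b, Some (inl i)) => Some (b, (val i, false))
  | (b, Some (inr (i, _))) => Some (b, (val i, true))
  end.

Definition edge_tgt (x : edge) : point :=
  match x with
  | (b, None) => Some (b, (0, false))
  | (b, Some (inl i)) => Some (b, if val i == n then (0, false) else (val i, true))
  | (b, Some (inr (i, _))) => Some (b, (i.+1, false))
  end.

Definition twin_rings : sgraph := line_graph edge_src edge_tgt.

(** The list of all adjacent pairs, each given in one orientation. Together with
    symmetry it reduces the verification of a colouring to a few families. *)
Lemma twin_rings_adj_ind (R : edge -> edge -> Prop) :
    (forall x y, R x y -> R y x) ->
    R (apex true) (apex false) ->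
    (forall b, R (apex b) (joint b ord0)) ->
    (forall b, R (apex b) (joint b ord_max)) ->
    (forall b, R (joint b ord0) (joint b ord_max)) ->
    (forall b (i : 'I_n) t, R (joint b (inord i)) (mid b i t)) ->
    (forall b (i : 'I_n) t, R (joint b (inord i.+1)) (mid b i t)) ->
    (forall b i, R (mid b i true) (mid b i false)) ->
  forall x y : twin_rings, adj x y -> R x y.
Proof.
move=> Rsym Raa Ra0 Ran R0n Rjm Rmj Rmm.
have eq_ordn (i : 'I_n.+1) : i = n :> nat -> i = ord_max by move=> ?; apply: val_inj.
have eq_ord0 (i : 'I_n.+1) : 0 = i :> nat -> i = ord0 by move=> ?; apply: val_inj.
have eq_inord (i : 'I_n.+1) m : i = m :> nat -> i = inord m by move=> <-; rewrite inord_val.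
(* The cases follow which end of one edge meets which end of the other. *)
have Rts x y : x != y -> edge_tgt x = edge_src y -> R x y.
  case: x y => [b [[i|[i t]]|]] [b' [[i'|[i' t']]|]] //= neq.
  - case: eqP => // i_n [] -> /eq_ord0 ->; rewrite (eq_ordn i i_n); exact/Rsym/R0n.
  - by case: eqP => // _ [] -> /eq_inord ->; apply: Rjm.
  - by case=> -> /esym/eq_inord ->; apply/Rsym/Rmj.
  - by case=> -> /eq_ord0 ->; apply: Ra0.
have Rss x y : x != y -> edge_src x = edge_src y -> R x y.
  case: x y => [b [[i|[i t]]|]] [b' [[i'|[i' t']]|]] //= neq.
  - by case=> eq_b /val_inj eq_i; rewrite eq_b eq_i eqxx in neq.
  - case=> eq_b /val_inj eq_i; move: neq; rewrite eq_b eq_i.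
    by case: t t' => [] [] //; rewrite ?eqxx // => _; [apply: Rmm | apply/Rsym/Rmm].
  - by move: neq; case: b b' => [] [] // _ _; apply/Rsym.
have Rtt x y : x != y -> edge_tgt x = edge_tgt y -> R x y.
  case: x y => [b [[i|[i t]]|]] [b' [[i'|[i' t']]|]] //= neq.
  - case: eqP => [/eq_ordn|] i_n; case: eqP => [/eq_ordn|] i'_n // [] eq_b.
      by rewrite eq_b i_n i'_n eqxx in neq.
    by move=> /val_inj eq_i; rewrite eq_b eq_i eqxx in neq.
  - by case: eqP.
  - by case: eqP => // /eq_ordn -> [] ->; apply/Rsym/Ran.
  - by case: eqP.
  - case=> eq_b /val_inj eq_i; move: neq; rewrite eq_b eq_i.
    by case: t t' => [] [] //; rewrite ?eqxx // => _; [apply: Rmm | apply/Rsym/Rmm].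
  - by case: eqP => // /eq_ordn -> [] ->; apply: Ran.
  - by case=> eq_b; rewrite eq_b eqxx in neq.
move=> x y /andP [neq /or4P [] /eqP E]; [exact: Rss | | exact: Rts | exact: Rtt].
by apply/Rsym/Rts; rewrite // eq_sym.
Qed.

(** The two triangles of a diamond share their middle edge, so each of the two
    joints is on the hub exactly when neither middle vertex is. *)
Lemma joint_hub_step (k : nat) (f : twin_rings -> wheel k) b (i : 'I_n) :
    3 < k -> is_hom f ->
  is_hub (f (joint b (inord i.+1))) = is_hub (f (joint b (inord i))).
Proof.
move=> k_gt3 f_hom.
have lt_i := ltn_ord i.
have adj_t t : adj (joint b (inord i) : twin_rings) (mid b i t).
  rewrite /= /line_adj /= !inordK ?(leqW lt_i) //.
  by rewrite ltn_eqF // eqxx !orbT; case: (b).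
have adj_t' t : adj (joint b (inord i.+1) : twin_rings) (mid b i t).
  by rewrite /= /line_adj /= !inordK ?ltnS // eqxx !orbT; case: (b).
have adj_tf : adj (mid b i true : twin_rings) (mid b i false).
  by apply/andP; split; [apply/eqP => -[] | rewrite /= eqxx].
have := wheel_triangle_hub k_gt3 (f_hom _ _ (adj_t true)) (f_hom _ _ adj_tf)
          (f_hom _ _ (adj_t false)).
have := wheel_triangle_hub k_gt3 (f_hom _ _ (adj_t' true)) (f_hom _ _ adj_tf)
          (f_hom _ _ (adj_t' false)).
by do 4!case: is_hub.
Qed.

Lemma joint_hub (k : nat) (f : twin_rings -> wheel k) b i :
    3 < k -> is_hom f -> i <= n ->
  is_hub (f (joint b (inord i))) = is_hub (f (joint b ord0)).
Proof.
move=> k_gt3 f_hom; elim: i => [_|i IHi lt_i].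
  by congr (is_hub (f (joint b _))); apply: val_inj; rewrite /= inordK.
by rewrite (joint_hub_step b (Ordinal lt_i) k_gt3 f_hom) /= IHi // ltnW.
Qed.

(** The joints a_0 and a_n are adjacent and have the same hub status, so neither
    is on the hub, and their triangle with the apex needs the apex there. *)
Lemma apex_hub (k : nat) (f : twin_rings -> wheel k) b :
  0 < n -> 3 < k -> is_hom f -> is_hub (f (apex b)).
Proof.
move=> n_gt0 k_gt3 f_hom.
have := joint_hub b k_gt3 f_hom (leqnn n).
have adj0 : adj (apex b : twin_rings) (joint b ord0).
  by rewrite /= /line_adj /= eqxx ?orbT; case: (b).
have adjn : adj (apex b : twin_rings) (joint b (inord n)).
  by rewrite /= /line_adj /= inordK // !eqxx ?orbT; case: (b).
have adj0n : adj (joint b ord0 : twin_rings) (joint b (inord n)).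
  rewrite /= /line_adj /= inordK // !eqxx ?orbT andbT.
  by apply/eqP => -[] /(congr1 val) /=; rewrite inordK //; lia.
have := wheel_triangle_hub k_gt3 (f_hom _ _ adj0) (f_hom _ _ adj0n) (f_hom _ _ adjn).
by do 3!case: is_hub.
Qed.

Lemma twin_rings_no_hom (k : nat) : 0 < n -> 3 < k -> ~ has_hom twin_rings (wheel k).
Proof.
move=> n_gt0 k_gt3 [f f_hom].
have /f_hom : adj (apex true : twin_rings) (apex false) by [].
have := apex_hub true n_gt0 k_gt3 f_hom; have := apex_hub false n_gt0 k_gt3 f_hom.
by rewrite /is_hub; case: (f _) => //; case: (f _).
Qed.

(** A colouring of the twin rings without the joint [j] of the ring [true]. In
    the broken ring the joints before the gap are on the hub and those after it
    off the hub, so that the apex sees at most the hub and the rim colour 1 and can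
    take the rim colour 0. This frees the hub for the apex of the ring [false], whose
    remaining long odd cycle a_0, m_0, a_1, m_1, ..., a_n, with m_i the middle
    vertex [mid false i false], follows the folded walk. *)
Definition broken_colouring (k : nat) (j : 'I_n.+1) (x : edge) : wheel k.+1 :=
  match x with
  | (true, None) => rim_colour k 0
  | (true, Some (inl i)) => if i < j then None else rim_colour k 1
  | (true, Some (inr (i, t))) =>
      if i < j then rim_colour k t else if t then None else rim_colour k 0
  | (false, None) => None
  | (false, Some (inl i)) => rim_colour k i.*2
  | (false, Some (inr (i, t))) => if t then None else rim_colour k i.*2.+1
  end.

Lemma broken_colouring_hom (k : nat) (j : 'I_n.+1) (x y : twin_rings) :
    odd k.+1 -> 1 < k -> k <= n.*2 ->
    adj x y -> x != joint true j -> y != joint true j ->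
  adj (broken_colouring k j x) (broken_colouring k j y).
Proof.
move=> k_odd k_gt1 le_kn.
have step i := rim_colour_step i k_odd k_gt1.
have step' i : adj (rim_colour k i.+1) (rim_colour k i) by rewrite adj_sym.
have close := rim_colour_close k_odd k_gt1 le_kn.
have s01 := step 0; have s10 := step' 0.
have joint_neq (i : 'I_n.+1) : joint true i != joint true j -> i <> j :> nat.
  by move=> /eqP ne /val_inj ij; apply: ne; rewrite ij.
move: x y; apply: twin_rings_adj_ind.
- by move=> x y Rxy xj yj; rewrite adj_sym; apply: Rxy.
- by [].
- by case=> // _ /joint_neq; rewrite /broken_colouring /joint; case: ifP.
- case=> // _ /joint_neq; rewrite /broken_colouring /joint.
  by case: ifP => [|_ _]; [have := ltn_ord j => /=; lia | exact: s01].
- case=> [/joint_neq /= j0 /joint_neq /= jn|_ _]; last exact: close.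
  by rewrite /broken_colouring /joint ifT ?ifF //=; have := ltn_ord j; lia.
- move=> b i t; have val_i : (inord i : 'I_n.+1) = i :> nat := inordK (leqW (ltn_ord i)).
  case: b; last by rewrite /broken_colouring /joint /mid val_i; case: t.
  move=> /joint_neq; rewrite /broken_colouring /joint /mid val_i.
  by case: (ltngtP i j) => // ij _ _; case: t.
- move=> b i t; have val_i : (inord i.+1 : 'I_n.+1) = i.+1 :> nat by rewrite inordK ?ltnS.
  case: b; last by rewrite /broken_colouring /joint /mid val_i doubleS; case: t.
  move=> /joint_neq; rewrite /broken_colouring /joint /mid val_i.
  by case: (ltngtP i.+1 j) => // ij _ _; case: t.
- case=> i _ _; rewrite /broken_colouring /mid //.
  by case: ifP.
Qed.

End TwinRings.

Theorem theorem19 (k : nat) (k_odd : odd k) (k_ge5 : 5 <= k) :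
  exists G : nat -> sgraph,
    (forall n : nat, claw_free_minimal_obstruction (wheel k) (G n)) /\
    (forall m n : nat, m <> n -> ~ isomorphic (G m) (G n)).
Proof.
apply: unbounded_nonisomorphic_family => N.
case: k k_odd k_ge5 => // k k_odd k_ge5.
pose n := k + N.
pose A : {set twin_rings n} := joint true @: [set: 'I_n.+1].
have cardA : #|A| = n.+1.
  by rewrite card_imset ?cardsT ?card_ord // => i j [].
have [||S /subsetPn [x xA xS]|K obsK ltK] :=
    @minimal_obstruction_inside (twin_rings n) (wheel k.+1) A.
- exact: line_graph_claw_free.
- by apply: twin_rings_no_hom; rewrite /n; lia.
- have [j _ x_j] := imsetP xA; exists (fun y => broken_colouring k j (val y)) => y z yz.
  have neq_j (u : induced S) : val u != joint true j.
    by rewrite -x_j; apply: contraNneq xS => <-; apply: valP.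
  by apply: broken_colouring_hom => //; rewrite /n; lia.
by exists K => //; apply: leq_trans ltK; rewrite cardA /n; lia.
Qed.
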